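(* Let $F:(\Sigma_1,\mathscr R_1)\to(\Sigma_2,\mathscr R_2)$ be a theory morphism between Dedukti theories. Then for all terms $M,N$ of $(\Sigma_1,\mathscr R_1)$: (1) $|M|_F\{|N|_F/x\}=|M\{N/x\}|_F$; (2) if $M\hookrightarrow_1N$ then $|M|_F\hookrightarrow_2^*|N|_F$; (3) if $M\equiv_1N$ then $|M|_F\equiv_2|N|_F$.
   Context: Dedukti: terms $x\mid c[\vec M]\mid\mathtt{TYPE}\mid\mathtt{KIND}\mid MN\mid\lambda x:A.M\mid\Pi x:A.B$ (constants with fixed arity), signatures of declarations $c[\Delta_c]:A_c$, rewrite rules $c[\vec l]\hookrightarrow r$; in theory $(\Sigma_i,\mathscr R_i)$, $\hookrightarrow_i$ is $\beta$ together with the context/substitution closure of $\mathscr R_i$, $\equiv_i$ its equivalence, and $\vdash_i$ Dedukti typing ($\lambda\Pi$-calculus with constants, conversion modulo $\equiv_i$). A theory pre-morphism $F$ assigns to each constant $c$ of $\Sigma_1$ a term $F_c$ over constants of $\Sigma_2$ whose free variables are among those of $\Delta_c$. It induces $|c[\vec M]|_F=F_c\{|\vec M|_F\}$ (simultaneous substitution of the arguments for the variables of $\Delta_c$), $|x|_F=x$, $|\mathtt{TYPE}|_F=\mathtt{TYPE}$, $|\mathtt{KIND}|_F=\mathtt{KIND}$, $|\Pi x:A.B|_F=\Pi x:|A|_F.|B|_F$, $|\lambda x:A.M|_F=\lambda x:|A|_F.|M|_F$, $|MN|_F=|M|_F|N|_F$, extended componentwise to contexts. It is a theory morphism if (i)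 for every $c[\Delta_c]:A_c\in\Sigma_1$, $\Sigma_2;|\Delta_c|_F\vdash_2F_c:|A_c|_F$, and (ii) for every rule $l\hookrightarrow r\in\mathscr R_1$, $|l|_F\hookrightarrow_2^*|r|_F$. *)

(* Defs.v *)
From mathcomp Require Import all_boot.
From Stdlib Require Import Relation_Definitions Relation_Operators.

Set Implicit Arguments.
Unset Strict Implicit.
Unset Printing Implicit Defensive.

Record language := Language { const : Type; arity : const -> nat }.

(* Terms up to alpha-equivalence, with de Bruijn indices.  In [Const c a], the
   argument [a i] is the one for the variable of index [i] of the context
   [Delta_c] of [c]; hence [a 0] is the last argument in the written order. *)
Inductive term (L : language) : Type :=
| Var of nat
| Const (c : const L) of {ffun 'I_(arity c) -> term L}
| TYPE
| KIND
| App of term L & term L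
| Lam of term L & term L
| Pi of term L & term L.

Arguments Var {L}.
Arguments Const {L}.
Arguments TYPE {L}.
Arguments KIND {L}.

Section Substitution.

Variable L : language.
Implicit Types (M N A B : term L) (s : nat -> term L).

Definition upren (r : nat -> nat) (x : nat) : nat :=
  if x is y.+1 then (r y).+1 else 0.

Fixpoint rename (r : nat -> nat) M : term L :=
  match M with
  | Var x => Var (r x)
  | Const c a => Const c [ffun i => rename r (a i)]
  | TYPE => TYPE
  | KIND => KIND
  | App M N => App (rename r M) (rename r N)
  | Lam A M => Lam (rename r A) (rename (upren r) M)
  | Pi A B => Pi (rename r A) (rename (upren r) B)
  end.

Definition shift (n : nat) M := rename (addn n) M.

Definition up s (x : nat) : term L := if x is y.+1 then shift 1 (s y) else Var 0.

Fixpoint subst s M : term L :=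
  match M with
  | Var x => s x
  | Const c a => Const c [ffun i => subst s (a i)]
  | TYPE => TYPE
  | KIND => KIND
  | App M N => App (subst s M) (subst s N)
  | Lam A M => Lam (subst s A) (subst (up s) M)
  | Pi A B => Pi (subst s A) (subst (up s) B)
  end.

(* [M{N/x}], where [x] stays in scope: [N] may itself mention [x]. *)
Definition subst1 (x : nat) N M : term L :=
  subst (fun y => if y == x then N else Var y) M.

(* [M{N/x}], where the binding of [x] is removed, so that [N] and the result
   live in the context of [M] deprived of [x]; beta is the case [x = 0]. *)
Definition inst1 (x : nat) N M : term L :=
  subst (fun y => if y == x then N else Var (if x < y then y.-1 else y)) M.

Definition inst_subst n (a : {ffun 'I_n -> term L}) (x : nat) : term L :=
  if insub x is Some i then a i else Var (x - n).

(* Simultaneous substitution of [a] for the variables [0, ..., n - 1]. *)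
Definition inst n (a : {ffun 'I_n -> term L}) M : term L :=
  subst (inst_subst a) M.

Fixpoint fv_below (n : nat) M : Prop :=
  match M with
  | Var x => x < n
  | Const c a => forall i, fv_below n (a i)
  | TYPE | KIND => True
  | App M N => fv_below n M /\ fv_below n N
  | Lam A M => fv_below n A /\ fv_below n.+1 M
  | Pi A B => fv_below n A /\ fv_below n.+1 B
  end.

End Substitution.

Record rule (L : language) := Rule {
  rule_head : const L;
  rule_args : {ffun 'I_(arity rule_head) -> term L};
  rule_rhs : term L }.

Definition rule_lhs (L : language) (rho : rule L) : term L :=
  Const (rule_head rho) (rule_args rho).

(* Every constant of the language is declared exactly once.  Contexts are
   sequences whose head is the type of the most recent variable (index 0). *)
Record theory := Theory {
  lang :> language;
  decl_ctx : forall c : const lang, (arity c).-tuple (term lang);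
  decl_type : const lang -> term lang;
  rules : rule lang -> Prop }.

Section Dedukti.

Variable T : theory.
Implicit Types (M N A B : term T) (G : seq (term T)).

Inductive step : relation (term T) :=
| step_beta A M N : step (App (Lam A M) N) (inst1 0 N M)
| step_rule rho s :
    rules rho -> step (subst s (rule_lhs rho)) (subst s (rule_rhs rho))
| step_Const c (a b : {ffun 'I_(arity c) -> term T}) i :
    step (a i) (b i) -> (forall j, j != i -> a j = b j) ->
    step (Const c a) (Const c b)
| step_AppL M M' N : step M M' -> step (App M N) (App M' N)
| step_AppR M N N' : step N N' -> step (App M N) (App M N')
| step_LamL A A' M : step A A' -> step (Lam A M) (Lam A' M)
| step_LamR A M M' : step M M' -> step (Lam A M) (Lam A M')
| step_PiL A A' B : step A A' -> step (Pi A B) (Pi A' B)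
| step_PiR A B B' : step B B' -> step (Pi A B) (Pi A B').

Definition steps : relation (term T) := clos_refl_trans _ step.

Definition conv : relation (term T) := clos_refl_sym_trans _ step.

Definition is_sort (S : term T) : Prop := S = TYPE \/ S = KIND.

Inductive wf_ctx : seq (term T) -> Prop :=
| wf_nil : wf_ctx [::]
| wf_cons G A : typing G A TYPE -> wf_ctx (A :: G)
with typing : seq (term T) -> term T -> term T -> Prop :=
| ty_TYPE G : wf_ctx G -> typing G TYPE KIND
| ty_Var G x :
    wf_ctx G -> x < size G -> typing G (Var x) (shift x.+1 (nth TYPE G x))
| ty_Const G c (a : {ffun 'I_(arity c) -> term T}) S :
    is_sort S -> typing (decl_ctx c) (decl_type c) S ->
    wf_ctx G ->
    (forall i : 'I_(arity c),
       typing G (a i) (inst a (shift i.+1 (tnth (decl_ctx c) i)))) ->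
    typing G (Const c a) (inst a (decl_type c))
| ty_Pi G A B S :
    is_sort S -> typing G A TYPE -> typing (A :: G) B S -> typing G (Pi A B) S
| ty_Lam G A B M S :
    is_sort S -> typing G A TYPE -> typing (A :: G) B S ->
    typing (A :: G) M B -> typing G (Lam A M) (Pi A B)
| ty_App G A B M N :
    typing G M (Pi A B) -> typing G N A -> typing G (App M N) (inst1 0 N B)
| ty_conv G A B M S :
    is_sort S -> typing G M A -> typing G B S -> conv A B -> typing G M B.

End Dedukti.

Record premorphism (T1 T2 : theory) := Premorphism {
  pm_term :> const T1 -> term T2;
  pm_scoped : forall c, fv_below (arity c) (pm_term c) }.

Section Morphism.

Variables (T1 T2 : theory) (F : premorphism T1 T2).

Fixpoint translate (M : term T1) : term T2 :=
  match M with
  | Var x => Var x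
  | Const c a => inst [ffun i => translate (a i)] (F c)
  | TYPE => TYPE
  | KIND => KIND
  | App M N => App (translate M) (translate N)
  | Lam A M => Lam (translate A) (translate M)
  | Pi A B => Pi (translate A) (translate B)
  end.

Record theory_morphism : Prop := TheoryMorphism {
  tm_typing : forall c : const T1,
    typing (map translate (decl_ctx c)) (F c) (translate (decl_type c));
  tm_rules : forall rho : rule T1, rules rho ->
    steps (translate (rule_lhs rho)) (translate (rule_rhs rho)) }.

End Morphism.

(* Main.v *)
(** The translation commutes with renamings and then with arbitrary
    substitutions; at a constant this needs that [F c] has no free variable
    besides those of the context of [c].  A step of the first theory is then
    simulated by induction: beta and rules by the substitution lemma and the
    stability of reduction under substitution, and a step in an argument of a
    constant [c] by the fact that reducing the terms substituted in [F c], each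
    occurring there any number of times, is a reduction of many steps. *)
Require Import Defs.
From mathcomp Require Import all_boot.
From Stdlib Require Import Relation_Definitions Relation_Operators.

Set Implicit Arguments.
Unset Strict Implicit.
Unset Printing Implicit Defensive.

(* The generated [term_ind] has no induction hypothesis for the arguments of
   [Const], which are nested in a finite function. *)
Lemma term_nested_ind (L : language) (P : term L -> Prop) :
  (forall x, P (Var x)) ->
  (forall c (a : {ffun 'I_(arity c) -> term L}),
     (forall i, P (a i)) -> P (Const c a)) ->
  P TYPE -> P KIND ->
  (forall M N, P M -> P N -> P (App M N)) ->
  (forall A M, P A -> P M -> P (Lam A M)) ->
  (forall A B, P A -> P B -> P (Pi A B)) ->
  forall M, P M.
Proof.
move=> hV hC hT hK hA hL hP.
fix IH 1 => -[x|c a| | |M N|A M|A B].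
- exact: hV.
- by apply: hC => i; apply: IH.
- exact: hT.
- exact: hK.
- by apply: hA; apply: IH.
- by apply: hL; apply: IH.
- by apply: hP; apply: IH.
Qed.

(** * Algebra of renamings and substitutions *)

Section SubstitutionTheory.

Variable L : language.
Implicit Types (M N A B : term L) (s t : nat -> term L) (r : nat -> nat).

Lemma up_below n s t :
  (forall x, x < n -> s x = t x) -> forall x, x < n.+1 -> up s x = up t x.
Proof. by move=> st [|x] //= /st ->. Qed.

(** This is how a scoping bound gets used: the values of a substitution outside the scope are
    irrelevant. Under a binder, the bound and the agreement both move up by one. *)
Lemma eq_subst_below M n s t :
  fv_below n M -> (forall x, x < n -> s x = t x) -> subst s M = subst t M.
Proof.
elim/term_nested_ind: M n s t => //=
  [x|c a IH|M N IHM IHN|A M IHA IHM|A B IHA IHB] n s t.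
- by move=> xn; apply.
- move=> an st; congr Const; apply/ffunP => i; rewrite !ffunE.
  exact: IH (an i) st.
- by move=> [Mn Nn] st; rewrite (IHM _ _ _ Mn st) (IHN _ _ _ Nn st).
- by move=> [An Mn] st; rewrite (IHA _ _ _ An st) (IHM _ _ _ Mn (up_below st)).
- by move=> [An Bn] st; rewrite (IHA _ _ _ An st) (IHB _ _ _ Bn (up_below st)).
Qed.

Lemma eq_up s t : s =1 t -> up s =1 up t.
Proof. by move=> st [|x] //=; rewrite st. Qed.

(** Substitutions are functions; this gives rewriting under binders from pointwise equality, without
    functional extensionality. *)
Lemma eq_subst M s t : s =1 t -> subst s M = subst t M.
Proof.
elim/term_nested_ind: M s t => //=
  [c a IH|M N IHM IHN|A M IHA IHM|A B IHA IHB] s t st.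
- by congr Const; apply/ffunP => i; rewrite !ffunE (IH i _ _ st).
- by rewrite (IHM _ _ st) (IHN _ _ st).
- by rewrite (IHA _ _ st) (IHM _ _ (eq_up st)).
- by rewrite (IHA _ _ st) (IHB _ _ (eq_up st)).
Qed.

Lemma renameE r M : rename r M = subst (fun x => Var (r x)) M.
Proof.
have upE q : (fun x => Var (upren q x)) =1 up (fun x => @Var L (q x)) by case.
elim/term_nested_ind: M r => //=
  [c a IH|M N IHM IHN|A M IHA IHM|A B IHA IHB] r.
- by congr Const; apply/ffunP => i; rewrite !ffunE IH.
- by rewrite IHM IHN.
- by rewrite IHA IHM (eq_subst _ (upE r)).
- by rewrite IHA IHB (eq_subst _ (upE r)).
Qed.

(** First of three composition laws. Since [up] shifts by a renaming, the binder case of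
    [subst_comp] relies on the two mixed laws, proved first. *)
Lemma subst_rename s r M : subst s (rename r M) = subst (fun x => s (r x)) M.
Proof.
have upE (t : nat -> term L) q :
    (fun x => up t (upren q x)) =1 up (fun x => t (q x)) by case.
elim/term_nested_ind: M s r => //=
  [c a IH|M N IHM IHN|A M IHA IHM|A B IHA IHB] s r.
- by congr Const; apply/ffunP => i; rewrite !ffunE IH.
- by rewrite IHM IHN.
- by rewrite IHA IHM (eq_subst _ (upE s r)).
- by rewrite IHA IHB (eq_subst _ (upE s r)).
Qed.

Lemma rename_subst r s M :
  rename r (subst s M) = subst (fun x => rename r (s x)) M.
Proof.
have upE q (t : nat -> term L) :
    (fun x => rename (upren q) (up t x)) =1 up (fun x => rename q (t x)).
  case=> [|x] //=; rewrite /shift [LHS]renameE subst_rename.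
  by rewrite [RHS]renameE subst_rename.
elim/term_nested_ind: M r s => //=
  [c a IH|M N IHM IHN|A M IHA IHM|A B IHA IHB] r s.
- by congr Const; apply/ffunP => i; rewrite !ffunE IH.
- by rewrite IHM IHN.
- by rewrite IHA IHM (eq_subst _ (upE r s)).
- by rewrite IHA IHB (eq_subst _ (upE r s)).
Qed.

Lemma subst_comp s t M :
  subst s (subst t M) = subst (fun x => subst s (t x)) M.
Proof.
have upE (p q : nat -> term L) :
    (fun x => subst (up p) (up q x)) =1 up (fun x => subst p (q x)).
  by case=> [|x] //=; rewrite /shift subst_rename rename_subst.
elim/term_nested_ind: M s t => //=
  [c a IH|M N IHM IHN|A M IHA IHM|A B IHA IHB] s t.
- by congr Const; apply/ffunP => i; rewrite !ffunE IH.
- by rewrite IHM IHN.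
- by rewrite IHA IHM (eq_subst _ (upE s t)).
- by rewrite IHA IHB (eq_subst _ (upE s t)).
Qed.

Lemma subst_Var M : subst Var M = M.
Proof.
have upE : up Var =1 @Var L by case.
elim/term_nested_ind: M => //= [c a IH|M N -> ->|A M IHA IHM|A B IHA IHB] //.
- by congr Const; apply/ffunP => i; rewrite ffunE IH.
- by rewrite IHA (eq_subst _ upE) IHM.
- by rewrite IHA (eq_subst _ upE) IHB.
Qed.

Lemma inst_subst_ord n (a : {ffun 'I_n -> term L}) (i : 'I_n) :
  inst_subst a i = a i.
Proof. by rewrite /inst_subst valK. Qed.

(** Both sides agree on the variables below [n]. At a variable [x] with [n <= x] the left gives
    [s (x - n)] but the right [Var (x - n)], hence the scoping hypothesis. *)
Lemma subst_inst n (a : {ffun 'I_n -> term L}) s M : fv_below n M ->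
  subst s (inst a M) = inst [ffun i => subst s (a i)] M.
Proof.
move=> Mn; rewrite /inst subst_comp; apply: (eq_subst_below Mn) => x xn.
by rewrite -[x]/(val (Ordinal xn)) !inst_subst_ord ffunE.
Qed.

Lemma subst_inst1 s M N :
  subst s (inst1 0 N M) = inst1 0 (subst s N) (subst (up s) M).
Proof.
rewrite /inst1 !subst_comp; apply: eq_subst => -[|x] //=.
(* Instantiating index 0 undoes the shift made by [up], so the composite acts on [s x] as the
   identity substitution. *)
by rewrite /shift subst_rename -[LHS]subst_Var; apply: eq_subst.
Qed.

End SubstitutionTheory.

(** * Closure properties of many-step reduction *)

Section Reduction.

Variable T : theory.
Implicit Types (M N A B : term T) (s t : nat -> term T).

Lemma steps_map (U : theory) (f : term T -> term U) :
  (forall M N, step M N -> steps (f M) (f N)) ->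
  forall M N, steps M N -> steps (f M) (f N).
Proof.
move=> fP M N; elim=> [{}M {}N /fP //|{}M|{}M P {}N _ MP _ PN].
- exact: rt_refl.
- exact: rt_trans MP PN.
Qed.

Lemma step_subst s M N : step M N -> step (subst s M) (subst s N).
Proof.
move=> MN; elim: MN s => {M N}
  [A M N|rho t rhoP|c a b i _ IH ab|M M' N _ IH|M N N' _ IH
  |A A' M _ IH|A M M' _ IH|A A' B _ IH|A B B' _ IH] s.
- by rewrite subst_inst1; apply: step_beta.
(* An instance of an instance of a rule is again an instance of it, by the composed substitution. *)
- by rewrite !subst_comp; apply: step_rule.
- apply: (@step_Const _ _ _ _ i) => [|j ji]; rewrite !ffunE //.
  by rewrite ab.
- exact: step_AppL.
- exact: step_AppR.
- exact: step_LamL.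
- exact: step_LamR.
- exact: step_PiL.
- exact: step_PiR.
Qed.

Lemma steps_subst s M N : steps M N -> steps (subst s M) (subst s N).
Proof.
by apply: steps_map => {}M {}N MN; apply/rt_step/step_subst.
Qed.

Lemma steps_App M M' N N' :
  steps M M' -> steps N N' -> steps (App M N) (App M' N').
Proof.
move=> MM' NN'; apply: (@rt_trans _ _ _ (App M' N)).
- by apply: (steps_map (f := fun P => App P N)) MM' => P Q PQ;
    apply/rt_step/step_AppL.
- by apply: steps_map NN' => P Q PQ; apply/rt_step/step_AppR.
Qed.

Lemma steps_Lam A A' M M' :
  steps A A' -> steps M M' -> steps (Lam A M) (Lam A' M').
Proof.
move=> AA' MM'; apply: (@rt_trans _ _ _ (Lam A' M)).
- by apply: (steps_map (f := fun P => Lam P M)) AA' => P Q PQ;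
    apply/rt_step/step_LamL.
- by apply: steps_map MM' => P Q PQ; apply/rt_step/step_LamR.
Qed.

Lemma steps_Pi A A' B B' :
  steps A A' -> steps B B' -> steps (Pi A B) (Pi A' B').
Proof.
move=> AA' BB'; apply: (@rt_trans _ _ _ (Pi A' B)).
- by apply: (steps_map (f := fun P => Pi P B)) AA' => P Q PQ;
    apply/rt_step/step_PiL.
- by apply: steps_map BB' => P Q PQ; apply/rt_step/step_PiR.
Qed.

(** The arguments are reduced one position at a time, along an enumeration of all positions. *)
Lemma steps_Const c (a b : {ffun 'I_(arity c) -> term T}) :
  (forall i, steps (a i) (b i)) -> steps (Const c a) (Const c b).
Proof.
move=> ab.
(* [h l] is the intermediate stage where exactly the positions in [l] have been treated. *)
pose h (l : seq 'I_(arity c)) := [ffun i => if i \in l then b i else a i].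
suff hP l : steps (Const c a) (Const c (h l)).
  have -> : b = h (enum 'I_(arity c)).
    by apply/ffunP => i; rewrite ffunE mem_enum.
  exact: hP.
elim: l => [|i l IHl].
  have -> : h [::] = a by apply/ffunP => i; rewrite ffunE.
  exact: rt_refl.
(* [u] is [h l] with a hole at [i]; filling it with [h l i] or [b i] gives the stages before and
   after. *)
pose u P := [ffun j => if j == i then P else h l j].
have -> : h (i :: l) = u (b i).
  by apply/ffunP => j; rewrite !ffunE inE; case: eqP => [->|].
apply: rt_trans IHl _.
have {1}-> : h l = u (h l i).
  by apply/ffunP => j; rewrite !ffunE; case: eqP => [->|].
apply: (steps_map (f := fun P => Const c (u P))) => [P Q PQ|].
  apply/rt_step/(@step_Const _ _ _ _ i) => [|j /negPf ji]; rewrite !ffunE.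
    by rewrite eqxx.
  by rewrite ji.
(* If [i] already occurs in [l], the hole already holds [b i]. *)
by rewrite ffunE; case: ifP => _; [apply: rt_refl|apply: ab].
Qed.

(** Each occurrence of a variable in [M] is reduced separately. Under a binder, shifted terms still
    reduce because shifting is a substitution. *)
Lemma steps_subst_pointwise M s t :
  (forall x, steps (s x) (t x)) -> steps (subst s M) (subst t M).
Proof.
have upP (p q : nat -> term T) : (forall x, steps (p x) (q x)) ->
    forall x, steps (up p x) (up q x).
  move=> pq [|x] /=; first exact: rt_refl.
  by rewrite /shift !renameE; apply: steps_subst.
elim/term_nested_ind: M s t => /=
  [x|c a IH| | |M N IHM IHN|A M IHA IHM|A B IHA IHB] s t st //.
- by apply: steps_Const => i; rewrite !ffunE; apply: IH.
- exact: rt_refl.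
- exact: rt_refl.
- by apply: steps_App; [apply: IHM|apply: IHN].
- by apply: steps_Lam; [apply: IHA|apply/IHM/upP].
- by apply: steps_Pi; [apply: IHA|apply/IHB/upP].
Qed.

Lemma steps_inst n (a b : {ffun 'I_n -> term T}) M :
  (forall i, steps (a i) (b i)) -> steps (inst a M) (inst b M).
Proof.
move=> ab; apply: steps_subst_pointwise => x; rewrite /inst_subst.
by case: insubP => [i _ _|_]; [apply: ab|apply: rt_refl].
Qed.

Lemma steps_conv M N : steps M N -> conv M N.
Proof.
elim=> [{}M {}N MN|{}M|{}M P {}N _ MP _ PN].
- exact: rst_step.
- exact: rst_refl.
- exact: rst_trans MP PN.
Qed.

End Reduction.

(** * Translation against substitution and reduction *)

Section Translation.

Variables (T1 T2 : theory) (F : premorphism T1 T2).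
Implicit Types (M N : term T1).

Lemma translate_rename r M :
  translate F (rename r M) = rename r (translate F M).
Proof.
elim/term_nested_ind: M r => //=
  [c a IH|M N IHM IHN|A M IHA IHM|A B IHA IHB] r.
(* All free variables of [F c] are replaced by arguments, so the renaming acts on the arguments
   only. *)
- rewrite [RHS]renameE subst_inst; last exact: pm_scoped.
  by congr inst; apply/ffunP => i; rewrite !ffunE IH renameE.
- by rewrite IHM IHN.
- by rewrite IHA IHM.
- by rewrite IHA IHB.
Qed.

Lemma translate_subst s M :
  translate F (subst s M) = subst (fun x => translate F (s x)) (translate F M).
Proof.
have upE t : (fun x => translate F (up t x)) =1 up (fun x => translate F (t x)).
  by case=> [|x] //=; rewrite /shift translate_rename.
elim/term_nested_ind: M s => //=
  [c a IH|M N IHM IHN|A M IHA IHM|A B IHA IHB] s.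
- rewrite subst_inst; last exact: pm_scoped.
  by congr inst; apply/ffunP => i; rewrite !ffunE IH.
- by rewrite IHM IHN.
- by rewrite IHA IHM (eq_subst _ (upE s)).
- by rewrite IHA IHB (eq_subst _ (upE s)).
Qed.

Lemma translate_subst1 x N M :
  translate F (subst1 x N M) = subst1 x (translate F N) (translate F M).
Proof. by rewrite /subst1 translate_subst; apply: eq_subst => y; case: eqP. Qed.

(** The case [x = 0] is what simulates a beta step. *)
Lemma translate_inst1 x N M :
  translate F (inst1 x N M) = inst1 x (translate F N) (translate F M).
Proof. by rewrite /inst1 translate_subst; apply: eq_subst => y; case: eqP. Qed.

Hypothesis F_rules : forall rho : rule T1, rules rho ->
  steps (translate F (rule_lhs rho)) (translate F (rule_rhs rho)).

Lemma translate_step M N :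
  step M N -> steps (translate F M) (translate F N).
Proof.
elim=> {M N} [A M N|rho s rhoP|c a b i _ IH ab|M M' N _ IH|M N N' _ IH
  |A A' M _ IH|A M M' _ IH|A A' B _ IH|A B B' _ IH].
- by rewrite translate_inst1; apply/rt_step/step_beta.
(* The translated instance of a rule is the translated rule under the translated substitution. *)
- by rewrite !translate_subst; apply/steps_subst/F_rules.
- apply: steps_inst => j; rewrite !ffunE.
  (* Only argument [i] moves, by the induction hypothesis; the others coincide. *)
  by have [->//|/ab->] := eqVneq j i; apply: rt_refl.
- by apply: steps_App => //; apply: rt_refl.
- by apply: steps_App => //; apply: rt_refl.
- by apply: steps_Lam => //; apply: rt_refl.
- by apply: steps_Lam => //; apply: rt_refl.
- by apply: steps_Pi => //; apply: rt_refl.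
- by apply: steps_Pi => //; apply: rt_refl.
Qed.

Lemma translate_conv M N : conv M N -> conv (translate F M) (translate F N).
Proof.
elim=> [{}M {}N MN|{}M|{}M {}N _|{}M P {}N _ MP _ PN].
- exact/steps_conv/translate_step.
- exact: rst_refl.
- exact: rst_sym.
- exact: rst_trans MP PN.
Qed.

End Translation.

Theorem mainTheorem17 (T1 T2 : theory) (F : premorphism T1 T2)
    (HF : theory_morphism F) (M N : term T1) :
  [/\ (forall x : nat,
         subst1 x (translate F N) (translate F M) = translate F (subst1 x N M)
         /\ inst1 x (translate F N) (translate F M) = translate F (inst1 x N M)),
      (step M N -> steps (translate F M) (translate F N))
    & (conv M N -> conv (translate F M) (translate F N))].
Proof.
split=> [x||].
- by rewrite translate_subst1 translate_inst1.
- exact: translate_step (tm_rules HF) M N.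
- exact: translate_conv (tm_rules HF) M N.
Qed.
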